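(* Let $d\ge 1$ and $\lambda>0$, and let $X_1,X_2,\ldots$ be i.i.d. random vectors in $\mathbb{R}^d$ whose $d$ coordinates are i.i.d. exponential random variables with parameter $\lambda$. Let $\{y_n\}$ be any sequence of positive edge distances and let $S=\sum_n n y_n^d$. For each $n$ let $G_n(y_n)$ be the graph on vertex set $\{X_1,\ldots,X_n\}$ in which $X_i$ and $X_j$ ($i\neq j$) are joined by an edge if and only if $\|X_i-X_j\|\le y_n$, and let $\Delta_n(y_n)$ be its maximum vertex degree. Then: 1. If $S<\infty$ and $y_n$ is non-increasing, then $P[\Delta_n(y_n)\ge 1 \text{ i.o.}]=0$. 2. If $S=\infty$, then $P[\Delta_n(y_n)\ge 1\text{ i.o.}]=1$.
   Context: The norm $\|\cdot\|$ is the $\ell_\infty$ norm on $\mathbb{R}^d$. The degree of $X_i$ in $G_n(y_n)$ is $\sum_{1\le j\ne i\le n}1_{\{\|X_i-X_j\|\le y_n\}}$, and $\Delta_n(y_n)$ is the maximum of these degrees over $1\le i\le n$; ''i.o.'' means for infinitely many $n$. *)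

(* Defs.v *)
From HB Require Import structures.
From mathcomp Require Import all_boot all_order all_algebra finmap.
From mathcomp Require Import all_classical all_reals all_analysis.
Set Implicit Arguments. Unset Strict Implicit. Unset Printing Implicit Defensive.
Import Order.TTheory GRing.Theory Num.Theory.
Local Open Scope classical_set_scope.
Local Open Scope ring_scope.

Definition mutually_independent d (T : measurableType d) (R : realType)
  (P : probability T R) (I : choiceType) (X : I -> T -> R) : Prop :=
  forall (J : {fset I}) (B : I -> set R),
    (forall i, i \in J -> measurable (B i)) ->
    P (\bigcap_(i in [set` J]) (X i @^-1` B i)) =
    (\prod_(i <- J) P (X i @^-1` B i))%E.

Definition linf_dist (R : realType) (dim : nat) (x y : 'I_dim -> R) : R :=
  \big[Num.max/0]_(k < dim) `|x k - y k|.

(* Degree of vertex X_(i+1) in G_n(r), vertices X_1..X_n indexed 0..n-1. *)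
Definition degree (R : realType) (dim : nat) (X : nat -> 'I_dim -> R)
  (n : nat) (r : R) (i : nat) : nat :=
  \sum_(j < n | j != i :> nat) (((linf_dist (X i) (X j) <= r)%R : bool) : nat).

Definition max_degree (R : realType) (dim : nat) (X : nat -> 'I_dim -> R)
  (n : nat) (r : R) : nat :=
  \max_(i < n) degree X n r i.

(* Main.v *)
Require Import Defs.
From HB Require Import structures.
From mathcomp Require Import all_boot all_order all_algebra finmap.
From mathcomp Require Import all_classical all_reals all_analysis.
From mathcomp Require Import measurable_realfun ring lra.
Set Implicit Arguments. Unset Strict Implicit. Unset Printing Implicit Defensive.
Import Order.TTheory GRing.Theory Num.Theory.
Local Open Scope classical_set_scope.
Local Open Scope ring_scope.

(** The variables [U = expR (- lambda * X)] are uniform on ]0, 1], so an interval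
    of length [p] inside ]0, 1] has probability exactly [p].  Independence is
    only ever used on boxes, so no product measure is needed.

    Convergence: covering by a grid of mesh comparable to [r] gives
    P(|X_i - X_j| <= r) <= (6 lambda r)^dim.  As [y] is non-increasing, for
    [N <= m] infinitely many edge events force either a pair of indices below
    [N] at distance at most [y m], or a pair [i < j] with [N <= j] at distance
    at most [y j]; the first probability vanishes as [m] grows, and the second
    is bounded by a tail of the series.

    Divergence: fix [0 < a < 1], keep the region where all the coordinates of
    [U] exceed [a], of probability [g = (1 - a)^dim], and cut it into equal
    cells whose pull-backs have diameter at most [y n].  The events "X_i and
    X_(n-1) lie in the same cell of level [n]" have probability [g * q n], and
    since all the cells of a level are equiprobable two distinct ones meet with
    probability at most [g * q n * q n'], even when they share a vertex.  The
    second moment method then bounds the probability that one of them occurs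
    below by [g - g / m], where [m] is a partial sum of a divergent series.
    Hence an edge appears after any time [N] with probability at least [g],
    and [g] tends to 1 as [a] tends to 0. *)

(** * Finite unions and the second moment method *)

Section finite_probability.
Context d (T : measurableType d) (R : realType) (P : probability T R).

(** Real-valued, so that estimates can be closed by [lra], [nra] and [field]. *)
Definition pr (A : set T) : R := fine (P A).

Lemma prE A : measurable A -> P A = (pr A)%:E.
Proof. by move=> mA; rewrite /pr fineK// fin_num_measure. Qed.

Lemma pr_ge0 A : 0 <= pr A.
Proof. by rewrite /pr fine_ge0. Qed.

Lemma le_pr A B : measurable A -> measurable B -> A `<=` B -> pr A <= pr B.
Proof.
move=> mA mB AB; rewrite -lee_fin -!prE//.
by apply: le_measure => //; rewrite inE.
Qed.

Lemma pr_le1 A : measurable A -> pr A <= 1.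
Proof. by move=> mA; rewrite -lee_fin -prE// probability_le1. Qed.

Lemma prU_le A B : measurable A -> measurable B ->
  pr (A `|` B) <= pr A + pr B.
Proof.
move=> mA mB; rewrite -lee_fin EFinD -!prE//; last exact: measurableU.
exact: measureU2.
Qed.

Lemma pr_setC A : measurable A -> pr (~` A) = 1 - pr A.
Proof.
move=> mA; apply: EFin_inj; rewrite EFinB -!prE//; last exact: measurableC.
exact: probability_setC.
Qed.

Lemma bigcup_enum (C : finType) (F : C -> set T) :
  \bigcup_c F c = \bigcup_(c in [set` enum C]) F c.
Proof. by congr bigcup; apply/seteqP; split=> c //= _; rewrite mem_enum. Qed.

Lemma measurable_bigcup_fin (C : finType) (F : C -> set T) :
  (forall c, measurable (F c)) -> measurable (\bigcup_c F c).
Proof. by move=> mF; apply: fin_bigcup_measurable. Qed.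

Lemma pr_bigcup (C : finType) (F : C -> set T) :
  (forall c, measurable (F c)) -> trivIset setT F ->
  pr (\bigcup_c F c) = \sum_c pr (F c).
Proof.
move=> mF tF; apply: EFin_inj; rewrite -prE; last exact: measurable_bigcup_fin.
rewrite bigcup_enum measure_fin_bigcup//; last exact: sub_trivIset tF.
rewrite -fsbig_seq ?enum_uniq// -sumEFin big_enum.
by apply: eq_bigr => c _; exact: prE.
Qed.

Lemma pr_bigcup_le (C : finType) (A : set T) (F : C -> set T) :
  measurable A -> (forall c, measurable (F c)) -> A `<=` \bigcup_c F c ->
  pr A <= \sum_c pr (F c).
Proof.
move=> mA mF; rewrite bigcup_enum => AF.
rewrite -lee_fin -prE// -sumEFin.
under eq_bigr do rewrite -prE//.
have := @content_sub_fsum _ _ _ P C [set` enum C] A F _ _ mA AF.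
by rewrite -fsbig_seq ?enum_uniq// big_enum; apply.
Qed.

Lemma integral_sum_indic (I : Type) (s : seq I) (G : I -> set T) (k : R) :
  0 <= k -> (forall i, measurable (G i)) ->
  (\int[P]_w (k * \sum_(i <- s) \1_(G i) w)%:E)%E
    = (k * \sum_(i <- s) pr (G i))%:E.
Proof.
move=> k0 mG; under eq_integral do rewrite EFinM -sumEFin.
have mi i : measurable_fun setT (fun w => (\1_(G i) w)%:E : \bar R).
  by apply/measurable_EFinP; exact: measurable_indic.
rewrite ge0_integralZl//; first last.
- by move=> w _; apply: sume_ge0 => i _; rewrite lee_fin.
- exact: emeasurable_sum.
rewrite EFinM ge0_integral_sum//; congr (_ * _)%E.
rewrite -sumEFin; apply: eq_bigr => i _.
by rewrite integral_indic// setIT -prE.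
Qed.

(* Expectation of the pointwise bound [\1_(\bigcup F c) >= 1 - (1 - t * W)^2],
   where [W] counts the events [F c] that occur. *)
Lemma pr_bigcup_ge (C : choiceType) (s : seq C) (F : C -> set T) (t : R) :
  (forall c, measurable (F c)) -> 0 <= t ->
  2 * t * \sum_(c <- s) pr (F c)
    - t ^+ 2 * \sum_(c <- s) \sum_(c' <- s) pr (F c `&` F c')
  <= pr (\bigcup_(c in [set` s]) F c).
Proof.
move=> mF t0.
have mU : measurable (\bigcup_(c in [set` s]) F c).
  by apply: fin_bigcup_measurable => // c _; exact: mF.
set U := \bigcup_(_ in _) _ in mU *.
pose ss := [seq (c, c') | c <- s, c' <- s].
pose FF (c : C * C) := F c.1 `&` F c.2.
have mFF c : measurable (FF c) by exact: measurableI.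
pose f1 w : \bar R := ((2 * t) * \sum_(c <- s) \1_(F c) w)%:E.
pose f2 w : \bar R := (t ^+ 2 * \sum_(c <- ss) \1_(FF c) w)%:E.
pose f3 w : \bar R := (\1_U w)%:E.
have f12 w : (f1 w <= f2 w + f3 w)%E.
  rewrite /f1 /f2 /f3 -EFinD lee_fin.
  pose W : R := \sum_(c <- s) \1_(F c) w.
  have -> : \sum_(c <- ss) \1_(FF c) w = W ^+ 2 :> R.
    rewrite big_allpairs expr2 mulr_suml; apply: eq_bigr => c _.
    by rewrite mulr_sumr; apply: eq_bigr => c' _; rewrite indicI.
  rewrite -/W; have [Uw|Uw] := pselect (U w).
    rewrite indicE mem_set//=; have := sqr_ge0 (1 - t * W); nra.
  suff -> : W = 0 by rewrite indicE memNset//= expr0n/= !mulr0 addr0.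
  rewrite /W big_seq; apply: big1 => c cs; rewrite indicE memNset// => Fw.
  by apply: Uw; exists c.
have E1 : (\int[P]_w f1 w)%E = (2 * t * \sum_(c <- s) pr (F c))%:E.
  by rewrite integral_sum_indic// mulr_ge0.
have E2 : (\int[P]_w f2 w)%E
    = (t ^+ 2 * \sum_(c <- s) \sum_(c' <- s) pr (F c `&` F c'))%:E.
  by rewrite integral_sum_indic ?exprn_ge0// big_allpairs.
have E3 : (\int[P]_w f3 w)%E = (pr U)%:E.
  by rewrite integral_indic// setIT -prE.
have m1 : measurable_fun setT f1.
  apply/measurable_EFinP; apply: measurable_funM => //.
  by apply: measurable_sum => i; exact: measurable_indic.
have m2 : measurable_fun setT f2.
  apply/measurable_EFinP; apply: measurable_funM => //.
  by apply: measurable_sum => i; exact: measurable_indic.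
have m3 : measurable_fun setT f3.
  by apply/measurable_EFinP; exact: measurable_indic.
have f10 w : (0 <= f1 w)%E.
  by rewrite lee_fin mulr_ge0// ?mulr_ge0// sumr_ge0.
have f20 w : (0 <= f2 w)%E.
  by rewrite lee_fin mulr_ge0// ?exprn_ge0// sumr_ge0.
have f30 w : (0 <= f3 w)%E by rewrite lee_fin.
rewrite lerBlDl -lee_fin EFinD -E1 -E2 -E3 -ge0_integralD//.
by apply: ge0_le_integral => //; exact: emeasurable_funD.
Qed.

(** Take [t = 1 / m], with [m] the sum of the [q c]. The first-moment term is then [2 * g]; the
    diagonal of the double sum contributes [g * m] and the rest at most [g * m ^+ 2], so at most
    [g / m + g] is subtracted. *)
Lemma pr_bigcup_second_moment (C : choiceType) (s : seq C) (F : C -> set T)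
    (g : R) (q : C -> R) : uniq s -> (forall c, measurable (F c)) ->
  (forall c, 0 <= q c) -> 0 < \sum_(c <- s) q c -> 0 <= g ->
  (forall c, c \in s -> pr (F c) = g * q c) ->
  (forall c c', c \in s -> c' \in s -> c != c' ->
    pr (F c `&` F c') <= g * q c * q c') ->
  g - g / (\sum_(c <- s) q c) <= pr (\bigcup_(c in [set` s]) F c).
Proof.
move=> us mF q0 m0 g0 Fc Fcc; set m := \sum_(c <- s) q c in m0 *.
have t0 : 0 <= m^-1 by rewrite invr_ge0 ltW.
apply: le_trans (pr_bigcup_ge s mF t0).
have -> : \sum_(c <- s) pr (F c) = g * m.
  by rewrite mulr_sumr; exact: eq_big_seq.
have : \sum_(c <- s) \sum_(c' <- s) pr (F c `&` F c') <= g * m + g * m ^+ 2.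
  have -> : g * m + g * m ^+ 2
      = \sum_(c <- s) (g * q c + \sum_(c' <- s) g * q c * q c').
    rewrite big_split/= -mulr_sumr -/m; congr (_ + _).
    under eq_bigr do rewrite -mulr_sumr -/m -mulrA.
    by rewrite -mulr_sumr -mulr_suml -/m expr2.
  rewrite big_seq [leRHS]big_seq; apply: ler_sum => c cs.
  rewrite (bigD1_seq c)//= setIid Fc// lerD2l [leRHS](bigD1_seq c)//=.
  (* The term [c' = c] of the right-hand sum is merely nonnegative and is discarded. *)
  rewrite -[leLHS]add0r lerD ?mulr_ge0 ?q0//.
  rewrite big_seq_cond [leRHS]big_seq_cond.
  by apply: ler_sum => c' /andP[c's c'c]; apply: Fcc => //; rewrite eq_sym.
move=> /(ler_wpM2l (exprn_ge0 2 t0)).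
have -> : m^-1 ^+ 2 * (g * m + g * m ^+ 2) = g / m + g by field; rewrite gt_eqF.
have -> : 2 / m * (g * m) = 2 * g by field; rewrite gt_eqF.
by move=> h; apply: le_trans (lerB (lexx _) h); lra.
Qed.

End finite_probability.

(** * Independence of boxes *)

Section boxes.
Context d (T : measurableType d) (R : realType) (P : probability T R).
Variables (dim : nat) (U : nat -> 'I_dim -> T -> R).
Hypothesis mU : forall i k, measurable_fun setT (U i k).
Hypothesis indU :
  mutually_independent P (fun p : nat * 'I_dim => U p.1 p.2).

Definition box (i : nat) (B : 'I_dim -> set R) : set T :=
  [set w | forall k, B k (U i k w)].

Definition boxes (s : seq nat) (F : nat -> 'I_dim -> set R) : set T :=
  [set w | forall i, i \in s -> box i (F i) w].

Lemma measurable_preU i k B : measurable B -> measurable (U i k @^-1` B).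
Proof. by move=> mB; rewrite -[_ @^-1` _]setTI; exact: mU. Qed.

Lemma boxE i B : box i B = \bigcap_k (U i k @^-1` B k).
Proof. by apply/seteqP; split=> w /= h k => [_|]; exact: h. Qed.

Lemma measurable_box i B : (forall k, measurable (B k)) -> measurable (box i B).
Proof.
move=> mB; rewrite boxE; apply: fin_bigcap_measurable => // k _.
exact: measurable_preU.
Qed.

Lemma boxes_cons i s F : boxes (i :: s) F = box i (F i) `&` boxes s F.
Proof.
apply/seteqP; split=> w.
  by move=> h; split=> [|j js]; apply: h; rewrite inE ?eqxx// js orbT.
by move=> [h1 h2] j; rewrite inE => /predU1P[->|] //; exact: h2.
Qed.

(** The event is an intersection over the pairs [(i, k)] listed in [l], so one use of independence
    factors it. As [l] has no duplicates, passing to a finite set of indices loses no factor. *)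
Lemma pr_boxes s F : uniq s -> (forall i k, measurable (F i k)) ->
  pr P (boxes s F) = \prod_(i <- s) \prod_k pr P (U i k @^-1` F i k).
Proof.
move=> us mF; pose l := [seq (i, k) | i <- s, k <- enum 'I_dim].
have ul : uniq l by apply: allpairs_uniq => //; [exact: enum_uniq|case=> ? ? []].
have -> : boxes s F
    = \bigcap_(p in [set` seq_fset tt l]) (U p.1 p.2 @^-1` F p.1 p.2).
  apply/seteqP; split=> w h.
    move=> p pl; have : p \in l by rewrite -(seq_fsetE tt).
    by move=> /allpairsP[[i k] /= [si _ ->]]; exact: h.
  move=> i si k; apply: (h (i, k)).
  suff : (i, k) \in seq_fset tt l by [].
  rewrite seq_fsetE.
  by apply/allpairsP; exists (i, k); split=> //=; rewrite mem_enum.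
apply: EFin_inj; rewrite -prE; last first.
  by apply: fin_bigcap_measurable => // p _; exact: measurable_preU.
rewrite (indU (B := fun p => F p.1 p.2))//.
transitivity
  (\prod_(p <- seq_fset tt l) (pr P (U p.1 p.2 @^-1` F p.1 p.2))%:E)%E.
  by apply: eq_bigr => p _; apply: prE; exact: measurable_preU.
rewrite prodEFin (perm_big _ (seq_fset_perm _ _)) undup_id// big_allpairs.
by congr EFin; apply: eq_bigr => i _; rewrite big_enum.
Qed.

Lemma pr_box i B : (forall k, measurable (B k)) ->
  pr P (box i B) = \prod_k pr P (U i k @^-1` B k).
Proof.
move=> mB; transitivity (pr P (boxes [:: i] (fun=> B))).
  congr (pr P _); apply/seteqP; split=> w h; first by move=> j /[!inE] /eqP ->.
  by apply: h; rewrite inE.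
by rewrite pr_boxes// big_seq1.
Qed.

Lemma pr_boxes_cons i s F : uniq (i :: s) -> (forall i k, measurable (F i k)) ->
  pr P (boxes (i :: s) F) = pr P (box i (F i)) * pr P (boxes s F).
Proof.
move=> us mF; have /andP[_ us'] := us.
by rewrite !pr_boxes// big_cons pr_box.
Qed.

(* [z = z'] is allowed: two pairs may share one vertex. *)
Lemma pr_box4 x x' z z' B B' C C' :
    (forall k, measurable (B k)) -> (forall k, measurable (B' k)) ->
    (forall k, measurable (C k)) -> (forall k, measurable (C' k)) ->
    x != x' -> x \notin [:: z; z'] -> x' \notin [:: z; z'] ->
  pr P ((box x B `&` box z C) `&` (box x' B' `&` box z' C'))
  = pr P (box x B) * pr P (box x' B') * pr P (box z C `&` box z' C').
Proof.
move=> mB mB' mC mC' xx' xz x'z.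
(* Implications avoid a case split: if [z = z'], that vertex receives both [C] and [C'], and the
   [undup] below lists it once. *)
pose F i k : set R := [set u | [/\ i = x -> B k u, i = x' -> B' k u,
  i = z -> C k u & i = z' -> C' k u]].
have mimp (Q : Prop) (A : set R) : measurable A -> measurable [set u | Q -> A u].
  move=> mA; have [q|nq] := pselect Q.
    rewrite (_ : [set _ | _] = A)//.
    by apply/seteqP; split=> u /= h; [exact: h|].
  by rewrite (_ : [set _ | _] = setT)//; apply/seteqP; split=> u //= _ q.
have mF i k : measurable (F i k).
  rewrite (_ : F i k = ([set u | i = x -> B k u] `&` [set u | i = x' -> B' k u])
    `&` ([set u | i = z -> C k u] `&` [set u | i = z' -> C' k u])).
    by apply: measurableI; apply: measurableI; exact: mimp.
  by apply/seteqP; split=> u /= [] // [] ? ? [].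
move: xz x'z; rewrite !inE !negb_or.
move=> /andP[/eqP xz /eqP xz'] /andP[/eqP x'z /eqP x'z'].
move/eqP in xx'.
pose s := undup [:: z; z'].
have sE i : (i \in s) = (i == z) || (i == z') by rewrite mem_undup !inE.
have bs : boxes s F = box z C `&` box z' C'.
  apply/seteqP; split=> w.
    move=> h; split=> k.
      by have := h z; rewrite sE eqxx => /(_ isT k)[_ _ + _]; apply.
    by have := h z'; rewrite sE eqxx orbT => /(_ isT k)[_ _ _]; apply.
  move=> [h h'] i; rewrite sE => /orP iz k.
  split=> e; [| |by rewrite e; exact: h|by rewrite e; exact: h'];
  by exfalso; case: iz => /eqP; rewrite e.
have bx : box x (F x) = box x B.
  apply/seteqP; split=> w h k; first by have [+ _ _ _] := h k; apply.
  by split.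
have bx' : box x' (F x') = box x' B'.
  apply/seteqP; split=> w h k; first by have [_ + _ _] := h k; apply.
  by split=> // /esym.
have us : uniq s by exact: undup_uniq.
have x's : x' \notin s by rewrite sE; apply/norP; split; exact/eqP.
have xs : x \notin x' :: s.
  by rewrite inE sE !negb_or; apply/and3P; split; exact/eqP.
have us2 : uniq (x' :: s) by rewrite cons_uniq x's.
have us3 : uniq [:: x, x' & s] by rewrite cons_uniq xs.
rewrite -bs -bx -bx' -mulrA -pr_boxes_cons// -pr_boxes_cons//.
by rewrite !boxes_cons bx bx' bs setIACA -setIA.
Qed.

Lemma pr_box2 x z B C :
    (forall k, measurable (B k)) -> (forall k, measurable (C k)) -> x != z ->
  pr P (box x B `&` box z C) = pr P (box x B) * pr P (box z C).
Proof.
move=> mB mC xz; pose F i := if i == x then B else C.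
have mF i k : measurable (F i k) by rewrite /F; case: ifP.
have Fx : F x = B by rewrite /F eqxx.
have Fz : F z = C by rewrite /F eq_sym (negbTE xz).
have bz : boxes [:: z] F = box z C.
  rewrite boxes_cons Fz (_ : boxes [::] F = setT) ?setIT//.
  by apply/seteqP; split.
have us : uniq [:: x; z] by rewrite cons_uniq inE xz.
by rewrite -bz -Fx -boxes_cons; exact: pr_boxes_cons.
Qed.

End boxes.

(** * Equiprobable grids *)

Section grid.
Context d (T : measurableType d) (R : realType) (P : probability T R).
Variables (dim : nat) (U : nat -> 'I_dim -> T -> R).
Hypothesis mU : forall i k, measurable_fun setT (U i k).
Hypothesis indU :
  mutually_independent P (fun p : nat * 'I_dim => U p.1 p.2).
Hypothesis uniformU : forall i k a b, 0 <= a -> a <= b -> b <= 1 ->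
  pr P (U i k @^-1` `]a, b]) = b - a.

Definition step (a : R) (L : nat) : R := (1 - a) / L%:R.

Definition cell (a : R) (L j : nat) : set R :=
  `]a + j%:R * step a L, a + j.+1%:R * step a L]%classic.

(** With [a > 0] this is the region kept for divergence; with [a = 0] it is an almost sure event. *)
Definition good (a : R) i : set T := box U i (fun=> `]a, 1]%classic).

Definition gcell a L i (c : {ffun 'I_dim -> 'I_L}) : set T :=
  box U i (fun k => cell a L (c k)).

Definition same_cell a L (x z : nat) : set T :=
  \bigcup_(c : {ffun 'I_dim -> 'I_L}) (gcell a x c `&` gcell a z c).

Lemma measurable_cell a L j : measurable (cell a L j).
Proof. exact: measurable_itv. Qed.

Lemma measurable_good a i : measurable (good a i).
Proof. by apply: measurable_box => // k; exact: measurable_itv. Qed.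

Lemma measurable_gcell a L i (c : {ffun 'I_dim -> 'I_L}) :
  measurable (gcell a i c).
Proof. by apply: measurable_box => // k; exact: measurable_cell. Qed.

Lemma measurable_same_cell a L x z : measurable (same_cell a L x z).
Proof.
apply: measurable_bigcup_fin => c.
by apply: measurableI; exact: measurable_gcell.
Qed.

Lemma same_cell_sym a L x z : same_cell a L x z = same_cell a L z x.
Proof. by apply: eq_bigcupr => c _; rewrite setIC. Qed.

Section fixed_level.
Variables (a : R) (L : nat).
Hypotheses (a0 : 0 <= a) (a1 : a < 1) (L0 : (0 < L)%N).

Lemma step_gt0 : 0 < step a L.
Proof. by rewrite divr_gt0 ?subr_gt0 ?ltr0n. Qed.

Lemma step_mul : L%:R * step a L = 1 - a.
Proof. by rewrite mulrC divfK// pnatr_eq0 -lt0n. Qed.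

Lemma cell_bounds j : (j < L)%N ->
  a <= a + j%:R * step a L /\ a + j.+1%:R * step a L <= 1.
Proof.
have p0 := step_gt0; move=> jL; split; first by rewrite lerDl mulr_ge0// ltW.
have := step_mul; have : j.+1%:R <= L%:R :> R by rewrite ler_nat.
by nra.
Qed.

Lemma cell_inj j j' u : cell a L j u -> cell a L j' u -> j = j'.
Proof.
have p0 := step_gt0; rewrite /cell /= !in_itv/= => /andP[h1 h2] /andP[h3 h4].
have H (m n : nat) : m%:R * step a L < n.+1%:R * step a L -> (m <= n)%N.
  by rewrite ltr_pM2r// ltr_nat ltnS.
apply/eqP; rewrite eqn_leq; apply/andP; split; apply: H; lra.
Qed.

Lemma cell_cover u : a < u -> u <= 1 -> exists j : 'I_L, cell a L j u.
Proof.
move=> au u1.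
have : u <= a + L%:R * step a L by rewrite step_mul; lra.
have : forall n, (n <= L)%N -> u <= a + n%:R * step a L ->
    exists j : 'I_L, cell a L j u.
  elim=> [|n IHn] nL; first by rewrite mul0r addr0 leNgt au.
  have [un _|nu un] := leP u (a + n%:R * step a L).
    by apply: IHn un; exact: ltnW.
  by exists (Ordinal nL); rewrite /cell /= in_itv/= nu un.
exact.
Qed.

Lemma bigcup_gcell i : \bigcup_c gcell a (L := L) i c = good a i.
Proof.
apply/seteqP; split=> w.
  move=> [c _ h] k; have [b1 b2] := cell_bounds (ltn_ord (c k)).
  have := h k; rewrite /cell /= !in_itv/= => /andP[h1 h2].
  by apply/andP; split; lra.
move=> h.
have /choice[f hf] : forall k, exists j : 'I_L, cell a L j (U i k w).
  by move=> k; have := h k; rewrite /= in_itv/= => /andP[]; exact: cell_cover.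
by exists [ffun k => f k] => // k; rewrite ffunE.
Qed.

Lemma trivIset_gcell i (Y : {ffun 'I_dim -> 'I_L} -> set T) :
  trivIset setT (fun c => gcell a i c `&` Y c).
Proof.
move=> c c' _ _ [w [[h _] [h' _]]]; apply/ffunP => k; apply/val_inj.
exact: cell_inj (h k) (h' k).
Qed.

Lemma pr_gcell i (c : {ffun 'I_dim -> 'I_L}) :
  pr P (gcell a i c) = step a L ^+ dim.
Proof.
rewrite pr_box//; last by move=> k; exact: measurable_cell.
rewrite -[dim in RHS]card_ord -prodr_const; apply: eq_bigr => k _.
have [b1 b2] := cell_bounds (ltn_ord (c k)); have p0 := step_gt0.
rewrite uniformU //.
- by rewrite -natr1; ring.
- exact: le_trans b1.
- by rewrite lerD2l ler_wpM2r ?ltW// ltr_nat.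
Qed.

Lemma pr_good i : pr P (good a i) = (1 - a) ^+ dim.
Proof.
rewrite pr_box//.
rewrite -[dim in RHS]card_ord -prodr_const; apply: eq_bigr => k _.
by rewrite uniformU// ltW.
Qed.

(** The cells partition the good region, so a vertex can be summed out against any event, without
    independence. *)
Lemma sum_gcell i (Y : set T) : measurable Y ->
  \sum_(c : {ffun 'I_dim -> 'I_L}) pr P (gcell a i c `&` Y)
  = pr P (good a i `&` Y).
Proof.
move=> mY; rewrite -pr_bigcup; first by rewrite -setI_bigcupl bigcup_gcell.
  by move=> c; apply: measurableI => //; exact: measurable_gcell.
exact: trivIset_gcell.
Qed.

Lemma card_gcell (e : R) :
  \sum_(c : {ffun 'I_dim -> 'I_L}) e = e * L%:R ^+ dim.
Proof. by rewrite sumr_const card_ffun !card_ord -natrX mulr_natr. Qed.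

(** Each of the [L ^ dim] cells contributes [step ^ (2 * dim)], and [L * step = 1 - a]. *)
Lemma pr_same_cell x z : x != z ->
  pr P (same_cell a L x z) = (1 - a) ^+ dim * step a L ^+ dim.
Proof.
move=> xz; rewrite pr_bigcup; last exact: trivIset_gcell.
  under eq_bigr => c _.
    rewrite pr_box2//; [|by move=> k; exact: measurable_cell..].
    rewrite !pr_gcell; over.
  by rewrite card_gcell -!exprMn -mulrA [_ * L%:R]mulrC step_mul mulrC.
by move=> c; apply: measurableI; exact: measurable_gcell.
Qed.

End fixed_level.

(** For a fixed pair of cells, [x] and [x'] are independent of the rest and contribute constant
    factors. Summing out the cells of [z] and [z'] leaves the event that both are good, of
    probability at most that of [good a z]; this covers [z = z']. *)
Lemma pr_same_cellI_le a L L' x x' z z' :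
    0 <= a -> a < 1 -> (0 < L)%N -> (0 < L')%N ->
    x != x' -> x \notin [:: z; z'] -> x' \notin [:: z; z'] ->
  pr P (same_cell a L x z `&` same_cell a L' x' z')
    <= (1 - a) ^+ dim * step a L ^+ dim * step a L' ^+ dim.
Proof.
move=> a0 a1 L0 L0' xx' xz x'z.
pose G (c : {ffun 'I_dim -> 'I_L} * {ffun 'I_dim -> 'I_L'}) :=
  (gcell a x c.1 `&` gcell a z c.1) `&` (gcell a x' c.2 `&` gcell a z' c.2).
have mG c : measurable (G c).
  by do 2!apply: measurableI => //; exact: measurable_gcell.
have : pr P (same_cell a L x z `&` same_cell a L' x' z') <= \sum_c pr P (G c).
  apply: pr_bigcup_le => //.
    by apply: measurableI; exact: measurable_same_cell.
  by move=> w [[c _ h] [c' _ h']]; exists (c, c').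
move=> /le_trans; apply.
under eq_bigr => c _.
  rewrite pr_box4//; [|by move=> k; exact: measurable_cell..].
  rewrite !pr_gcell//; over.
rewrite -mulr_sumr -[leRHS]mulrA [leRHS]mulrC ler_wpM2l//.
  by rewrite mulr_ge0// exprn_ge0// ltW// step_gt0.
rewrite -(pair_bigA _ (fun c c' => pr P (gcell a z c `&` gcell a z' c')))/=.
under eq_bigr => c _.
  under eq_bigr do rewrite setIC.
  rewrite sum_gcell//; last exact: measurable_gcell.
  rewrite setIC; over.
rewrite sum_gcell//; last exact: measurable_good.
rewrite -(pr_good a0 a1 z); apply: le_pr => //; last exact: measurable_good.
by apply: measurableI; exact: measurable_good.
Qed.

(** The endpoints may leave [0, 1]. Clamping them by [cl] does not increase the length, and loses
    only values of [U] outside ]0, 1], which have probability 0. *)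
Lemma pr_itv_le i k a b : a <= b -> pr P (U i k @^-1` `]a, b]) <= b - a.
Proof.
move=> ab; have mV (S : set R) := @measurable_preU _ _ _ _ _ mU i k S.
pose D : set T := U i k @^-1` `]0, 1]%classic.
have D1 : pr P D = 1 by rewrite uniformU// subr0.
have mD : measurable D by apply: mV; exact: measurable_itv.
pose cl t : R := Num.min (Num.max t 0) 1.
have cl01 t : 0 <= cl t <= 1.
  by rewrite /cl le_min ge_min lexx orbT andbT ler01 andbT le_max lexx orbT.
have clle : cl a <= cl b.
  by rewrite /cl /Num.min /Num.max; do !case: ifP; lra.
have cl_sub : cl b - cl a <= b - a.
  by rewrite /cl /Num.min /Num.max; do !case: ifP; lra.
have : pr P (U i k @^-1` `]a, b])
    <= pr P ((U i k @^-1` `]cl a, cl b]) `|` ~` D).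
  apply: le_pr; [by apply: mV; exact: measurable_itv| |].
    by apply: measurableU; [apply: mV; exact: measurable_itv|exact: measurableC].
  move=> w; rewrite /= in_itv/= => /andP[aw wb].
  have [Dw|Dw] := pselect (D w); last by right.
  left; move: Dw; rewrite /D /= !in_itv/= => /andP[w0 w1].
  by rewrite /cl /Num.min /Num.max; do !case: ifP; lra.
move=> /le_trans; apply; apply: le_trans (prU_le _ _ _) _.
- by apply: mV; exact: measurable_itv.
- exact: measurableC.
rewrite pr_setC// D1 subrr addr0 uniformU//; have /andP[] := cl01 a => //.
by have /andP[] := cl01 b.
Qed.

Definition coords_close (i j : nat) (s : R) : set T :=
  [set w | forall k, `|U i k w - U j k w| <= s].

Lemma measurable_coords_close i j s : measurable (coords_close i j s).
Proof.
rewrite (_ : coords_close i j s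
    = \bigcap_k ((fun w => `|U i k w - U j k w|) @^-1` `]-oo, s]%classic)).
  apply: fin_bigcap_measurable => // k _; rewrite -[_ @^-1` _]setTI.
  have mf : measurable_fun setT (fun w => `|U i k w - U j k w|).
    by apply: measurableT_comp => //; exact: measurable_funB.
  by apply: mf => //; exact: measurable_itv.
by apply/seteqP; split=> w h k; have := h k; rewrite /= in_itv/=; [|apply].
Qed.

(** With a mesh [p] between [s] and [2 * s], a point in a given cell forces the other into a cube of
    side [3 * p]. Summing over the cells gives [(3 * p) ^+ dim]. *)
Lemma pr_coords_close_le i j s : i != j -> 0 < s ->
  pr P (coords_close i j s) <= (6 * s) ^+ dim.
Proof.
move=> ij s0; have mN := measurable_coords_close i j s.
have [s1|s1] := ltP 1 s.
  by apply: le_trans (pr_le1 _ mN) _; rewrite exprn_ege1//; lra.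
(* As [s <= 1], [L] is at least 1, and [s <= 1 / L <= 2 * s]. *)
pose L := Num.truncn s^-1.
have L0 : (0 < L)%N by rewrite truncn_gt0 invr_ge1// unitfE gt_eqF.
have Lr0 : 0 < L%:R :> R by rewrite ltr0n.
have /andP[Ls sL] : L%:R <= s^-1 < L.+1%:R.
  by apply: truncn_itv; rewrite invr_ge0 ltW.
have pE : step 0 L = L%:R^-1 by rewrite /step subr0 mul1r.
have sp : s <= step 0 L by rewrite pE -[s]invrK lef_pV2// posrE invr_gt0.
have ps : step 0 L <= 2 * s.
  rewrite pE -[L%:R^-1]mul1r ler_pdivrMr//.
  have : s * s^-1 < s * L.+1%:R by rewrite ltr_pM2l.
  rewrite divff ?gt_eqF// -natr1; have : 1 <= L%:R :> R by rewrite ler1n.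
  by nra.
have p0 : 0 < step 0 L by apply: lt_le_trans sp.
(* The cell widened by one mesh on each side; it may stick out of ]0, 1], whence [pr_itv_le]. *)
pose N c : 'I_dim -> set R := fun k =>
  `]c k * step 0 L - step 0 L, c k * step 0 L + 2 * step 0 L]%classic.
have mN' c k : measurable (N c k) by exact: measurable_itv.
pose G (c : {ffun 'I_dim -> 'I_L}) : set T :=
  gcell 0 i c `&` box U j (N (fun k => (c k)%:R)).
have mG c : measurable (G c).
  by apply: measurableI; [exact: measurable_gcell|exact: measurable_box].
have mC : measurable (~` good 0 i) by apply: measurableC; exact: measurable_good.
have sub : coords_close i j s `<=` (\bigcup_c G c) `|` ~` good 0 i.
  move=> w nw; have [gw|] := pselect (good 0 i w); last by right.
  left; move: gw; rewrite -(@bigcup_gcell 0 L)// => -[c _ cw].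
  exists c => //; split=> // k; have := cw k; have := nw k.
  rewrite /cell /N/= !in_itv/= add0r add0r -natr1 ler_norml.
  by move=> /andP[h1 h2] /andP[h3 h4]; apply/andP; split; lra.
apply: le_trans (le_pr _ mN _ sub) _.
  by apply: measurableU => //; exact: measurable_bigcup_fin.
apply: le_trans (prU_le _ _ mC) _; first exact: measurable_bigcup_fin.
rewrite pr_setC; last exact: measurable_good.
rewrite (pr_good (lexx 0) ltr01) subr0 expr1n subrr addr0.
have : pr P (\bigcup_c G c) <= \sum_c pr P (G c).
  by apply: pr_bigcup_le => //; exact: measurable_bigcup_fin.
move=> /le_trans; apply.
have : \sum_c pr P (G c)
    <= \sum_(c : {ffun 'I_dim -> 'I_L}) step 0 L ^+ dim * (3 * step 0 L) ^+ dim.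
  apply: ler_sum => c _; rewrite pr_box2//; last first.
    by move=> k; exact: measurable_cell.
  rewrite pr_gcell// ler_wpM2l ?exprn_ge0 ?(ltW p0)//.
  rewrite pr_box// -[dim in leRHS]card_ord -prodr_const.
  apply: ler_prod => k _; rewrite pr_ge0/=.
  by apply: le_trans (pr_itv_le _ _ _) _; lra.
move=> /le_trans; apply.
rewrite card_gcell -!exprMn mulrAC [_ * L%:R]mulrC step_mul// subr0 mul1r.
by apply: lerXn2r; rewrite ?nnegrE; lra.
Qed.

End grid.

(** * The exponential law *)

Section exponential_law.
Context (R : realType) (lambda : R).
Hypothesis lambda0 : 0 < lambda.

(** The open end at [t] matches the complement of the event [expR (- lambda * X) <= b]. The density
    vanishes on the negatives, which reduces the integral to [0, t]. *)
Lemma exponential_prob_itvNyo (t : R) : 0 <= t ->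
  exponential_prob lambda `]-oo, t[%classic = (1 - expR (- lambda * t))%:E.
Proof.
move=> t0; have [->|tn0] := eqVneq t 0.
  rewrite mulr0 expR0 subrr /exponential_prob integral0_eq// => x.
  by rewrite /= in_itv/= => x0; rewrite lt0_exponential_pdf.
have {}t0 : 0 < t by rewrite lt_neqAle eq_sym tn0.
rewrite EFinB -(exponential_prob_itv0c lambda t0) /exponential_prob.
have mf A : measurable A -> measurable_fun A (EFin \o exponential_pdf lambda).
  move=> mA; apply/measurable_EFinP; apply: measurable_funTS.
  exact: measurable_exponential_pdf.
rewrite -integral_itv_bndo_bndc; last exact: mf.
rewrite (_ : `[0, t[%classic = `]-oo, t[ `&` `[0, +oo[); last first.
  apply/seteqP; split=> x /=; rewrite !in_itv/= andbT.
    by move=> /andP[].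
  by move=> [? ?]; apply/andP.
rewrite integral_mkcondr; apply: eq_integral => x _.
rewrite patchE; case: ifPn => // /negP x0.
rewrite lt0_exponential_pdf// ltNge; apply/negP => x0'; apply: x0.
by rewrite inE/= in_itv/= x0'.
Qed.

Context d (T : measurableType d) (P : probability T R) (X : {RV P >-> R}).
Hypothesis lawX : forall B : set R, measurable B ->
  P ((X : T -> R) @^-1` B) = exponential_prob lambda B.

Lemma pr_expR_le (b : R) : 0 <= b -> b <= 1 ->
  pr P [set w | expR (- lambda * X w) <= b] = b.
Proof.
(* At [b = 0] the threshold [- ln b / lambda] is meaningless, but the event is empty. *)
move=> b0 b1; have [->|bn0] := eqVneq b 0.
  rewrite (_ : [set _ | _] = set0) /pr ?measure0//.
  by apply/seteqP; split=> w //=; rewrite leNgt expR_gt0.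
have {}b0 : 0 < b by rewrite lt_neqAle eq_sym bn0.
pose t := - ln b / lambda.
have t0 : 0 <= t by rewrite divr_ge0 ?(ltW lambda0)// oppr_ge0 ln_le0.
have bE : b = expR (- lambda * t).
  have -> : - lambda * t = ln b by rewrite /t; field; rewrite gt_eqF.
  by rewrite lnK.
have mB : measurable (X @^-1` `]-oo, t[%classic).
  by rewrite -[_ @^-1` _]setTI; exact: measurable_funPT.
rewrite (_ : [set _ | _] = ~` (X @^-1` `]-oo, t[%classic)).
  rewrite pr_setC//; have -> : pr P (X @^-1` `]-oo, t[%classic) = 1 - b.
    by rewrite /pr lawX ?exponential_prob_itvNyo// -bE.
  by ring.
apply/seteqP; split=> w /=;
  rewrite in_itv/= {1}bE ler_expR !mulNr lerN2 ler_pM2l//.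
  by move=> tX; apply/negP; rewrite -leNgt.
by move=> /negP; rewrite -leNgt.
Qed.

Lemma measurable_expR_RV : measurable_fun setT (fun w => expR (- lambda * X w)).
Proof. by apply: measurableT_comp => //; exact: measurable_funM. Qed.

Lemma pr_expR_itv (a b : R) : 0 <= a -> a <= b -> b <= 1 ->
  pr P ((fun w => expR (- lambda * X w)) @^-1` `]a, b]) = b - a.
Proof.
move=> a0 ab b1; set U := fun w => expR _.
have mU (B : set R) : measurable B -> measurable (U @^-1` B).
  by move=> mB; rewrite -[_ @^-1` _]setTI; exact: measurable_expR_RV.
have Eb : pr P (U @^-1` `]-oo, b]) = b.
  by rewrite -[RHS](pr_expR_le (le_trans a0 ab) b1); congr (pr P _);
     apply/seteqP; split=> w; rewrite /= in_itv.
have Ea : pr P (U @^-1` `]-oo, a]) = a.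
  by rewrite -[RHS](pr_expR_le a0 (le_trans ab b1)); congr (pr P _);
     apply/seteqP; split=> w; rewrite /= in_itv.
have : pr P (U @^-1` `]-oo, b])
    = pr P (U @^-1` `]-oo, a]) + pr P (U @^-1` `]a, b]).
  have mI := mU _ (@measurable_itv R _).
  apply: EFin_inj; rewrite EFinD -!prE// -measureU//; last first.
    apply/seteqP; split=> w //=; rewrite !in_itv/= => -[wa /andP[aw _]].
    by move: wa; rewrite leNgt aw.
  congr (P _); apply/seteqP; split=> w /=; rewrite !in_itv/=.
    by move=> ->; rewrite andbT; case: (leP (U w) a); [left|right].
  by case=> [wa|/andP[]//]; exact: le_trans ab.
by rewrite Ea Eb; lra.
Qed.

(** Factor out [expR (- lambda * u) <= 1] and use [1 - expR (- s) <= s]. *)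
Lemma expRN_lipschitz (u v : R) : 0 <= u -> u <= v ->
  expR (- lambda * u) - expR (- lambda * v) <= lambda * (v - u).
Proof.
move=> u0 uv.
have -> : expR (- lambda * v)
    = expR (- lambda * u) * expR (- (lambda * (v - u))).
  by rewrite -expRD; congr expR; ring.
have e1 : expR (- lambda * u) <= 1.
  by rewrite -expR0 ler_expR mulNr oppr_le0 mulr_ge0// ltW.
have e0 := expR_gt0 (- lambda * u).
have := expR_ge1Dx (- (lambda * (v - u))).
have : 0 <= lambda * (v - u) by rewrite mulr_ge0 ?subr_ge0// ltW.
by nra.
Qed.

Lemma dist_expR_le (x x' r : R) : 0 <= x -> 0 <= x' -> `|x - x'| <= r ->
  `|expR (- lambda * x) - expR (- lambda * x')| <= lambda * r.
Proof.
wlog xx' : x x' / x <= x'.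
  move=> H x0 x'0; have [xx'|/ltW x'x] := leP x x'; first exact: H.
  by move=> h; rewrite distrC; apply: H => //; rewrite distrC.
move=> x0 x'0; rewrite distrC ger0_norm ?subr_ge0// => xr.
rewrite ger0_norm ?subr_ge0 ?ler_expR; last first.
  by rewrite !mulNr lerN2 ler_pM2l.
by apply: le_trans (expRN_lipschitz x0 xx') _; rewrite ler_pM2l.
Qed.

(** Above the level [a] the inverse map is Lipschitz with constant [1 / (lambda * a)]: for
    [x <= x'], the difference of the exponentials is at least
    [expR (- lambda * x') * lambda * (x' - x)]. *)
Lemma dist_expR_ge (x x' a s : R) : 0 < a ->
  a < expR (- lambda * x) -> a < expR (- lambda * x') ->
  `|expR (- lambda * x) - expR (- lambda * x')| <= s ->
  `|x - x'| <= s / (lambda * a).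
Proof.
move=> a0; wlog xx' : x x' / x <= x'.
  move=> H ax ax'; have [xx'|/ltW x'x] := leP x x'; first exact: H.
  by move=> h; rewrite distrC; apply: H => //; rewrite distrC.
move=> ax ax' ss; rewrite distrC ger0_norm ?subr_ge0//.
rewrite ler_pdivlMr ?mulr_gt0//.
have {}ss : expR (- lambda * x) - expR (- lambda * x') <= s.
  exact: le_trans (ler_norm _) ss.
have E : expR (- lambda * x)
    = expR (- lambda * x') * expR (lambda * (x' - x)).
  by rewrite -expRD; congr expR; ring.
have := expR_ge1Dx (lambda * (x' - x)).
have : 0 <= lambda * (x' - x) by rewrite mulr_ge0 ?subr_ge0// ltW.
move: ss ax'; rewrite E.
set f := expR (lambda * _); set e := expR _; set t := lambda * (x' - x).
move=> h1 h2 h3 h4.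
have -> : (x' - x) * (lambda * a) = t * a by rewrite /t; ring.
have : t * a <= t * e by rewrite ler_wpM2l// ltW.
have : e * (1 + t) <= e * f by rewrite ler_wpM2l// ltW// (lt_trans a0).
by lra.
Qed.

End exponential_law.

(** * Sup distance, maximum degree and Bernoulli's inequality *)

Lemma linf_distC (R : realType) dim (x x' : 'I_dim -> R) :
  linf_dist x x' = linf_dist x' x.
Proof. by apply: eq_bigr => k _; rewrite distrC. Qed.

Lemma linf_dist_leP (R : realType) dim (x x' : 'I_dim -> R) (r : R) : 0 <= r ->
  linf_dist x x' <= r <-> forall k, `|x k - x' k| <= r.
Proof.
move=> r0; split; first by move=> /bigmax_leP[_ h] k; exact: h.
by move=> h; apply/bigmax_leP; split.
Qed.

(** Symmetry of the distance allows the pair to be ordered, so that edges can be sorted by their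
    later endpoint. *)
Lemma max_degree_gt0P (R : realType) dim (Y : nat -> 'I_dim -> R) n (r : R) :
  (0 < max_degree Y n r)%N <->
  exists i j : nat, [/\ (i < j)%N, (j < n)%N & linf_dist (Y i) (Y j) <= r].
Proof.
have degP i : reflect
    (exists2 j : 'I_n, j != i :> nat & linf_dist (Y i) (Y j) <= r)
    (0 < degree Y n r i)%N.
  rewrite lt0n /degree sum_nat_eq0 negb_forall.
  apply: (iffP existsP) => [[j]|[j ji h]].
    rewrite negb_imply => /andP[ji]; case: (boolP (_ <= _)) => // h _.
    by exists j.
  by exists j; rewrite ji h.
have maxP : (0 < max_degree Y n r)%N <-> exists i : 'I_n, (0 < degree Y n r i)%N.
  split=> [|[i hi]]; last by apply: leq_trans hi _; exact: leq_bigmax.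
  rewrite ltnNge => /negP h; apply: contrapT => h'; apply: h.
  apply/bigmax_leqP => i _; rewrite leqNgt; apply/negP => hi.
  by apply: h'; exists i.
split=> [/maxP[i /degP[j ji h]]|[i [j [ij jn h]]]].
  move: ji; rewrite neq_ltn => /orP[ji|ij].
    by exists j, i; split; rewrite // linf_distC.
  by exists i, j; split.
apply/maxP; exists (Ordinal (ltn_trans ij jn)); apply/degP.
by exists (Ordinal jn) => //=; rewrite gtn_eqF.
Qed.

Lemma ler_bernoulli (R : realDomainType) (a : R) n : 0 <= a -> a <= 1 ->
  1 - n%:R * a <= (1 - a) ^+ n.
Proof.
move=> a0 a1; elim: n => [|n IHn]; first by rewrite mul0r subr0 expr0.
rewrite exprS -natr1; have n0 : 0 <= n%:R :> R by [].
have : (1 - a) * (1 - n%:R * a) <= (1 - a) * (1 - a) ^+ n.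
  by rewrite ler_wpM2l// subr_ge0.
have : 0 <= n%:R * (a * a) by rewrite !mulr_ge0.
by lra.
Qed.

(** * Edge events *)

Lemma sum_sub_index_iota (R : numDomainType) (u : nat -> R) m n m' n' :
  (forall j, 0 <= u j) -> (m' <= m)%N -> (n <= n')%N ->
  \sum_(m <= j < n) u j <= \sum_(m' <= j < n') u j.
Proof.
move=> u0 mm nn; have [mn|nm] := leqP m n; last first.
  by rewrite big_geq ?sumr_ge0// ltnW.
rewrite [leRHS](big_cat_nat mm (leq_trans mn nn))/=.
rewrite [X in _ <= _ + X](big_cat_nat mn nn)/=.
by rewrite addrCA lerDl addr_ge0 ?sumr_ge0.
Qed.

Lemma nneseries_bounded (R : realType) (u : nat -> R) (K : R) :
  (forall n, 0 <= u n) -> (forall n, \sum_(0 <= j < n) u j <= K) ->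
  (\sum_(0 <= n <oo) (u n)%:E < +oo)%E.
Proof.
move=> u0 uK; apply: (@le_lt_trans _ _ K%:E); last exact: ltry.
apply: lime_le; first by apply: is_cvg_nneseries => n _ _; rewrite lee_fin.
by apply: nearW => n; rewrite sumEFin lee_fin.
Qed.

(** The weight [j * q j.+1] counts the [j] pairs ending at vertex [j], at level [j.+1]. If these
    sums stayed below [K], a late [y j.+1 >= 1] would give a single term above [K]; so eventually
    [y < 1], the minimum disappears, and comparison with [j.+1 <= 2 * j] makes the series finite. *)
Lemma partial_sums_unbounded (R : realType) (dim : nat) (y q : nat -> R)
    (c : R) :
  (0 < dim)%N -> 0 < c -> (forall n, 0 < y n) ->
  (forall n, (c * Num.min 1 (y n)) ^+ dim <= q n) ->
  (\sum_(0 <= n <oo) ((n%:R * y n ^+ dim)%:E))%E = +oo%E ->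
  forall (N : nat) (K : R), exists M, K < \sum_(N <= j < M) j%:R * q j.+1.
Proof.
move=> dim0 c0 y0 yq yoo N K; apply: contrapT => noM.
have sumK M : \sum_(N <= j < M) j%:R * q j.+1 <= K.
  by rewrite leNgt; apply/negP => h; apply: noM; exists M.
have m0 n : 0 < Num.min 1 (y n) by rewrite lt_min ltr01 y0.
have q0 n : 0 <= q n.
  by apply: le_trans (yq n); rewrite exprn_ge0// mulr_ge0// ltW.
have jq0 j : 0 <= j%:R * q j.+1 by rewrite mulr_ge0.
have K0 : 0 <= K by apply: le_trans (sumK N); rewrite big_geq.
have cd0 : 0 < c ^+ dim by rewrite exprn_gt0.
(* Beyond [n0] one has [j >= N], [j >= 1] and [j * c ^+ dim > K]. *)
pose n0 := (maxn N (Num.truncn (K / c ^+ dim))).+1.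
have small j : (n0 <= j)%N -> y j.+1 < 1.
  move=> jn0; rewrite ltNge; apply/negP => y1.
  have := yq j.+1; rewrite (min_idPl y1) mulr1 => cq.
  have Nj : (N <= j)%N.
    by apply: leq_trans jn0; rewrite /n0 ltnW// ltnS leq_maxl.
  have := sumK j.+1; rewrite big_nat_recr//= => h.
  have : \sum_(N <= i < j) i%:R * q i.+1 >= 0 by apply: sumr_ge0.
  have : j%:R * c ^+ dim <= j%:R * q j.+1 by rewrite ler_wpM2l.
  have : K < j%:R * c ^+ dim.
    rewrite -ltr_pdivrMr//; apply: lt_le_trans (truncnS_gt _) _.
    by rewrite ler_nat; apply: leq_trans jn0; rewrite /n0 ltnS leq_maxr.
  by lra.
have term j : (n0 <= j)%N ->
    j.+1%:R * y j.+1 ^+ dim <= 2 / c ^+ dim * (j%:R * q j.+1).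
  move=> jn0; have := yq j.+1; rewrite (min_idPr (ltW (small _ jn0))) exprMn => h.
  have j1 : 1 <= j%:R :> R by rewrite ler1n; apply: leq_trans jn0.
  have -> : 2 / c ^+ dim * (j%:R * q j.+1) = 2 * j%:R * (q j.+1 / c ^+ dim).
    by ring.
  apply: ler_pM => //; first by rewrite exprn_ge0// ltW.
    by rewrite -natr1; lra.
  by rewrite ler_pdivlMr// mulrC.
have v0 n : 0 <= n%:R * y n ^+ dim by rewrite mulr_ge0// exprn_ge0// ltW.
suff : (\sum_(0 <= n <oo) (n%:R * y n ^+ dim)%:E < +oo)%E by rewrite yoo.
pose A := \sum_(0 <= n < n0.+1) n%:R * y n ^+ dim.
apply: (@nneseries_bounded _ _ (A + 2 / c ^+ dim * K)) => // n.
apply: (@le_trans _ _ (\sum_(0 <= j < n0.+1 + n) j%:R * y j ^+ dim)).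
  by apply: sum_sub_index_iota => //; rewrite leq_addl.
rewrite (@big_cat_nat _ _ _ n0.+1)//= ?leq_addr// lerD2l addSn big_add1/=.
apply: (@le_trans _ _
    (\sum_(n0 <= j < n0 + n) 2 / c ^+ dim * (j%:R * q j.+1))).
  by rewrite big_nat [leRHS]big_nat; apply: ler_sum => j /andP[/term].
rewrite -mulr_sumr ler_wpM2l//; first by rewrite divr_ge0// ltW.
apply: le_trans (sumK (n0 + n)%N); apply: sum_sub_index_iota => //.
by rewrite /n0 leqW// leq_maxl.
Qed.

(** * Adjacency in the exponential sample *)

Section exponential_sample.
Context dP (T : measurableType dP) (R : realType) (P : probability T R).
Variables (dim : nat) (lambda : R) (X : nat -> 'I_dim -> {RV P >-> R}).
Hypothesis lambda0 : 0 < lambda.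
Hypothesis indX :
  mutually_independent P (fun p : nat * 'I_dim => (X p.1 p.2 : T -> R)).
Hypothesis lawX : forall (i : nat) (k : 'I_dim) (B : set R), measurable B ->
  P ((X i k : T -> R) @^-1` B) = exponential_prob lambda B.

Let U (i : nat) (k : 'I_dim) : T -> R := fun w => expR (- lambda * X i k w).

Let mU i k : measurable_fun setT (U i k).
Proof. exact: measurable_expR_RV. Qed.

Let indU : mutually_independent P (fun p : nat * 'I_dim => U p.1 p.2).
Proof.
move=> J B mB.
have mexp : measurable_fun setT (fun x : R => expR (- lambda * x)).
  by apply: measurableT_comp => //; exact: measurable_funM.
apply: (indX (B := fun p => (fun x : R => expR (- lambda * x)) @^-1` B p)).
by move=> i iJ; rewrite -[_ @^-1` _]setTI; apply: mexp => //; exact: mB.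
Qed.

Let uniformU i k a b : 0 <= a -> a <= b -> b <= 1 ->
  pr P (U i k @^-1` `]a, b]) = b - a.
Proof. exact: (pr_expR_itv lambda0 (@lawX i k)). Qed.

Definition adjacent (i j : nat) (r : R) : set T :=
  [set w | linf_dist (X i ^~ w) (X j ^~ w) <= r].

(** Edges are grouped by their later endpoint. *)
Definition hit (j : nat) (r : R) : set T := \bigcup_(i : 'I_j) adjacent i j r.

Lemma measurable_adjacent i j r : 0 <= r -> measurable (adjacent i j r).
Proof.
move=> r0; rewrite (_ : adjacent i j r
    = coords_close (fun i k => X i k : T -> R) i j r).
  by apply: measurable_coords_close => ? ?; exact: measurable_funPT.
by apply/seteqP; split=> w /(linf_dist_leP _ _ r0).
Qed.

Lemma measurable_hit j r : 0 <= r -> measurable (hit j r).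
Proof. by move=> r0; apply: measurable_bigcup_fin => i; exact: measurable_adjacent. Qed.

(** Where [U <= 1], hence almost surely, the coordinates of [X] are nonnegative, and there [X]
    within [r] puts [U] within [lambda * r]. *)
Lemma pr_adjacent_le i j r : i != j -> 0 < r ->
  pr P (adjacent i j r) <= (6 * lambda) ^+ dim * r ^+ dim.
Proof.
move=> ij r0; have mC := measurable_adjacent i j (ltW r0).
have mN := measurable_coords_close mU i j (lambda * r).
have mG l : measurable (~` good U 0 l).
  by apply: measurableC; exact: measurable_good.
have G0 l : pr P (~` good U 0 l) = 0.
  rewrite pr_setC; last exact: measurable_good.
  by rewrite (pr_good mU indU uniformU (lexx 0) ltr01) subr0 expr1n subrr.
have good_ge0 l k w : good U 0 l w -> 0 <= X l k w.
  move=> /(_ k); rewrite /= in_itv/= => /andP[_].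
  by rewrite -expR0 /U ler_expR mulNr oppr_le0 pmulr_rge0.
have sub : adjacent i j r
    `<=` coords_close U i j (lambda * r) `|` (~` good U 0 i `|` ~` good U 0 j).
  move=> w /(linf_dist_leP _ _ (ltW r0)) cw.
  have [gi|] := pselect (good U 0 i w); last by right; left.
  have [gj|] := pselect (good U 0 j w); last by right; right.
  left=> k; apply: dist_expR_le => //; exact: good_ge0.
apply: le_trans (le_pr P mC _ sub) _.
  by apply: measurableU => //; exact: measurableU.
apply: le_trans (prU_le _ mN _) _; first exact: measurableU.
rewrite -exprMn -mulrA -[leRHS]addr0; apply: lerD.
  by apply: (pr_coords_close_le mU indU uniformU) => //; rewrite mulr_gt0.
by apply: le_trans (prU_le _ _ _) _; rewrite // !G0 addr0.
Qed.

Lemma pr_hit_le j r : 0 < r ->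
  pr P (hit j r) <= (6 * lambda) ^+ dim * (j%:R * r ^+ dim).
Proof.
move=> r0; have mC i := measurable_adjacent i j (ltW r0).
apply: (@le_trans _ _ (\sum_(i < j) pr P (adjacent i j r))).
  by apply: pr_bigcup_le => //; exact: measurable_hit (ltW r0).
apply: (@le_trans _ _ (\sum_(i < j) (6 * lambda) ^+ dim * r ^+ dim)).
  by apply: ler_sum => i _; apply: pr_adjacent_le => //; rewrite ltn_eqF.
by rewrite sumr_const card_ord -[leLHS]mulr_natl mulrCA.
Qed.

Lemma same_cell_sub_adjacent a L i j r : 0 < a -> a < 1 -> (0 < L)%N ->
  step a L / (lambda * a) <= r -> same_cell U a L i j `<=` adjacent i j r.
Proof.
move=> a0 a1 L0 hr w [c _ [ci cj]].
have p0 : 0 < step a L by exact: step_gt0.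
have r0 : 0 <= r.
  apply: le_trans hr.
  by rewrite divr_ge0 ?(ltW p0)// mulr_ge0 ?(ltW a0) ?(ltW lambda0).
apply/(linf_dist_leP _ _ r0) => k; apply: le_trans hr.
have [b1 b2] := cell_bounds a1 L0 (ltn_ord (c k)).
have := ci k; have := cj k; rewrite /cell /U /= !in_itv/= -natr1.
move=> /andP[h1 h2] /andP[h3 h4]; apply: (dist_expR_ge lambda0 a0).
- exact: le_lt_trans b1 h3.
- exact: le_lt_trans b1 h1.
- by rewrite ler_norml; apply/andP; split; lra.
Qed.

(** * Edge events along the sequence [y] and their upper limit *)

Variable y : nat -> R.
Hypothesis y0 : forall n, 0 < y n.

Let E n := [set w : T | (1 <= max_degree (fun i k => X i k w) n (y n))%N].

Lemma edge_eventE n : E n = \bigcup_(j : 'I_n) hit j (y n).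
Proof.
apply/seteqP; split=> w.
  move=> /max_degree_gt0P[i [j [ij jn h]]].
  by exists (Ordinal jn) => //; exists (Ordinal ij).
move=> [j _ [i _ h]]; apply/max_degree_gt0P; exists i, j; split=> //.
Qed.

Lemma measurable_edge_event n : measurable (E n).
Proof.
rewrite edge_eventE; apply: measurable_bigcup_fin => j.
by apply: measurable_hit; exact: ltW.
Qed.

Lemma lim_sup_edge_event0 :
  (\sum_(0 <= n <oo) ((n%:R * y n ^+ dim)%:E) < +oo)%E ->
  (forall m n : nat, (m <= n)%N -> y n <= y m) ->
  P (lim_sup_set E) = 0%E.
Proof.
move=> Sfin ymono; set C := (6 * lambda) ^+ dim.
have C0 : 0 <= C by rewrite exprn_ge0// mulr_ge0// ltW.
have v0 n : (0 <= (n%:R * y n ^+ dim)%:E)%E.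
  by rewrite lee_fin mulr_ge0// exprn_ge0// ltW.
pose A j := hit j (y j).
have mA j : measurable (A j) by apply: measurable_hit; exact: ltW.
have PA j : (P (A j) <= C%:E * (j%:R * y j ^+ dim)%:E)%E.
  by rewrite prE// -EFinM lee_fin pr_hit_le.
have sumA : (\sum_(0 <= j <oo) P (A j) < +oo)%E.
  apply: le_lt_trans (lee_nneseries _ (fun j _ => PA j)) _ => //.
  rewrite nneseriesZl//; apply: lte_mul_pinfty => //.
have mlim : measurable (lim_sup_set E).
  apply: bigcap_measurable => // n _; apply: bigcup_measurable => m _.
  exact: measurable_edge_event.
have small (f : nat -> \bar R) (e : R) : (forall n, 0 <= f n)%E ->
    (\sum_(0 <= j <oo) f j < +oo)%E -> 0 < e ->
    exists N0, forall N, (N0 <= N)%N -> (\sum_(N <= j <oo) f j < e%:E)%E.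
  move=> f0 fin e0; have := nneseries_tail_cvg fin (fun n _ => f0 n).
  move=> /(_ [set x | (x < e%:E)%E]) [|N0 _ h].
    by apply: open_nbhs_nbhs; split; [exact: open_ereal_lt_ereal|rewrite /= lte_fin].
  by exists N0 => N N0N; exact: h.
apply/eqP; rewrite -measure_le0; apply/lee_addgt0Pr => e e0; rewrite add0e.
have e20 : 0 < e / 2 by rewrite divr_gt0.
have [N hN] := small (fun j => P (A j)) _ (fun j => measure_ge0 P (A j)) sumA e20.
(* The union bound on [B] below is [N * C * N * y m ^+ dim]; the [+ 1] keeps the denominator
   positive when [N = 0]. *)
have e30 : 0 < e / 2 / (N%:R * (C * N%:R) + 1).
  by rewrite divr_gt0// ltr_wpDl// !mulr_ge0.
have [m0 hm0] := small _ _ v0 Sfin e30.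
pose m := maxn (maxn N m0) 1%N.
have mN : (N <= m)%N by rewrite /m -maxnA leq_maxl.
have m1 : (1 <= m)%N by rewrite leq_maxr.
pose B : set T := \bigcup_(j : 'I_N) hit j (y m).
have mB : measurable B.
  by apply: measurable_bigcup_fin => j; apply: measurable_hit; exact: ltW.
pose tA : set T := \bigcup_(j in ~` `I_N) A j.
have mtA : measurable tA by apply: bigcup_measurable => j _.
have sub : lim_sup_set E `<=` B `|` tA.
  move=> w /(_ m I)[n /= mn]; rewrite edge_eventE => -[j _ [i _ h]].
  have [jN|Nj] := ltnP j N.
    left; exists (Ordinal jN) => //; exists i => //.
    by apply: le_trans h _; exact: ymono.
  right; exists (j : nat); first by apply/negP; rewrite -leqNgt.
  exists i => //; apply: le_trans h _; apply: ymono; exact: ltnW.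
have PB : (P B <= (e / 2)%:E)%E.
  rewrite prE// lee_fin.
  apply: (@le_trans _ _ (\sum_(j < N) pr P (hit j (y m)))).
    by apply: pr_bigcup_le => // j; apply: measurable_hit; exact: ltW.
  apply: (@le_trans _ _ (\sum_(j < N) C * (N%:R * y m ^+ dim))).
    apply: ler_sum => j _; apply: le_trans (pr_hit_le _ (y0 m)) _.
    rewrite ler_wpM2l// ler_wpM2r//; first by rewrite exprn_ge0// ltW.
    by rewrite ler_nat ltnW.
  rewrite sumr_const card_ord -mulr_natl.
  have ymE : y m ^+ dim < e / 2 / (N%:R * (C * N%:R) + 1).
    rewrite -lte_fin; apply: le_lt_trans (hm0 m _); last first.
      by rewrite /m leq_max leq_max leqnn orbT.
    (* The tail from [m] dominates its first term [m * y m ^+ dim], and [m >= 1]. *)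
    apply: le_trans (nneseries_lim_ge m.+1 _); last by [].
    rewrite big_nat1 lee_fin ler_peMl ?exprn_ge0 ?(ltW (y0 m))//.
    by rewrite ler1n.
  have D0 : 0 < N%:R * (C * N%:R) + 1 :> R by rewrite ltr_wpDl// !mulr_ge0.
  move: ymE; rewrite ltr_pdivlMr// => ymE; apply: le_trans (ltW ymE).
  have ym0 : 0 <= y m ^+ dim by rewrite exprn_ge0// ltW.
  by rewrite [leRHS]mulrDr mulr1; nra.
have PtA : (P tA <= (e / 2)%:E)%E.
  apply: le_trans (ltW (hN N (leqnn N))).
  exact: measure_sigma_subadditive_tail.
apply: le_trans (le_measure P _ _ sub) _; rewrite ?inE//.
  exact: measurableU.
apply: le_trans (measureU2 P mB mtA) _.
by apply: le_trans (leeD PB PtA) _; rewrite -EFinD lee_fin; lra.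
Qed.

Lemma pr_bigcup_edge_event_ge (a : R) (N : nat) : (0 < dim)%N ->
  (\sum_(0 <= n <oo) ((n%:R * y n ^+ dim)%:E))%E = +oo%E ->
  0 < a -> a < 1 ->
  (1 - a) ^+ dim <= pr P (\bigcup_(n in [set n | (N <= n)%N]) E n).
Proof.
move=> dim0 Soo a0 a1; set g := (1 - a) ^+ dim.
have g0 : 0 < g by rewrite exprn_gt0// subr_gt0.
(* Enough cells for [step / (lambda * a) <= y n], so that sharing a cell implies adjacency. *)
pose L n := (Num.truncn ((1 - a) / (lambda * a * y n))).+1.
have L0 n : (0 < L n)%N by [].
have la0 : 0 < lambda * a by rewrite mulr_gt0.
have Lge n : step a (L n) / (lambda * a) <= y n.
  rewrite ler_pdivrMr// /step ler_pdivrMr ?ltr0n// mulrC [y n * _]mulrC.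
  by rewrite -ler_pdivrMr ?mulr_gt0//; apply: ltW; exact: truncnS_gt.
(* Rounding up adds at most one cell, so [L n <= (1 - a) / (lambda * a * y n) + 1]; this [c] is the
   resulting constant in [step >= c * min(1, y n)], attained at [y n = 1]. *)
pose c := (1 - a) * (lambda * a) / (1 - a + lambda * a).
have s0 : 0 < 1 - a + lambda * a by rewrite addr_gt0// subr_gt0.
have c0 : 0 < c by rewrite divr_gt0// mulr_gt0// subr_gt0.
pose q n := step a (L n) ^+ dim.
have q0 n : 0 <= q n by rewrite exprn_ge0// ltW// step_gt0.
have cq n : (c * Num.min 1 (y n)) ^+ dim <= q n.
  have mn0 : 0 < Num.min 1 (y n) by rewrite lt_min ltr01 y0.
  apply: lerXn2r; rewrite ?nnegrE ?(ltW (step_gt0 _ _))//.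
    by rewrite mulr_ge0// ltW.
  rewrite /step ler_pdivlMr ?ltr0n//.
  have tr : (L n)%:R <= (1 - a) / (lambda * a * y n) + 1.
    rewrite /L -natr1 lerD2r truncn_le// divr_ge0//.
      by rewrite subr_ge0 ltW.
    by rewrite !mulr_ge0// ltW.
  have cm0 : 0 <= c * Num.min 1 (y n) by rewrite mulr_ge0// ltW.
  apply: le_trans (ler_wpM2l cm0 tr) _.
  have cE : 1 - a = c * ((1 - a) / (lambda * a)) + c.
    by rewrite /c; field; rewrite !gt_eqF.
  rewrite [leRHS]cE.
  rewrite mulrDr mulr1; apply: lerD; last first.
    by rewrite ler_piMr ?(ltW c0)// ge_min lexx.
  rewrite -[leLHS]mulrA ler_wpM2l ?(ltW c0)//.
  have -> : Num.min 1 (y n) * ((1 - a) / (lambda * a * y n))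
     = (1 - a) / (lambda * a) * (Num.min 1 (y n) / y n).
    by field; rewrite !gt_eqF.
  rewrite ler_piMr//; first by rewrite divr_ge0 ?subr_ge0// ltW.
  by rewrite ler_pdivrMr// mul1r ge_min lexx orbT.
have unb := partial_sums_unbounded dim0 c0 y0 cq Soo N.
apply/ler_addgt0Pr => e e0.
have [M hM] := unb (g / e).
(* The pair [(i, j)] is tested only at level [j.+1], the first graph that contains vertex [j]. *)
pose s := [seq (i, j) | j <- index_iota N M, i <- iota 0 j].
have sP p : p \in s -> (p.1 < p.2)%N /\ (N <= p.2)%N.
  move=> /allpairsPdep[j [i [jI iI ->]]] /=.
  by move: jI iI; rewrite mem_index_iota mem_iota add0n => /andP[].
have us : uniq s.
  apply: allpairs_uniq_dep; first exact: iota_uniq.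
    by move=> j _; exact: iota_uniq.
  by move=> [j i] [j' i'] _ _ /= [-> ->].
have sumq : \sum_(p <- s) q p.2.+1 = \sum_(N <= j < M) j%:R * q j.+1.
  rewrite big_allpairs_dep; apply: eq_bigr => j _.
  by rewrite /= big_const_seq count_predT size_iota iter_addr_0 mulr_natl.
have mpos : 0 < \sum_(p <- s) q p.2.+1.
  by rewrite sumq (lt_trans _ hM)// divr_gt0.
pose F (p : nat * nat) := same_cell U a (L p.2.+1) p.1 p.2.
have mF p : measurable (F p) by exact: measurable_same_cell.
have mEU : measurable (\bigcup_(n in [set n | (N <= n)%N]) E n).
  by apply: bigcup_measurable => n _; exact: measurable_edge_event.
have FE : \bigcup_(p in [set` s]) F p
    `<=` \bigcup_(n in [set n | (N <= n)%N]) E n.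
  move=> w [[i j] /= /sP[/= ij Nj] h]; exists j.+1; first exact: leqW.
  rewrite edge_eventE; exists ord_max => //=; exists (Ordinal ij) => //=.
  by apply: (same_cell_sub_adjacent a0 a1 (L0 j.+1) (Lge j.+1)).
have Fpair p p' : p \in s -> p' \in s -> p != p' ->
    pr P (F p `&` F p') <= g * q p.2.+1 * q p'.2.+1.
  wlog le_p : p p' / (p.2 <= p'.2)%N.
    move=> H ps p's pp'; have [h|/ltnW h] := leqP p.2 p'.2; first exact: H.
    by rewrite setIC mulrAC; apply: H; rewrite // eq_sym.
  case: p p' le_p => i j [i' j'] /= le_j /sP[/= ij _] /sP[/= ij' _].
  rewrite xpair_eqE negb_and => ne.
  have key l m l' m' : same_cell U a (L j.+1) l m = F (i, j) ->
      same_cell U a (L j'.+1) l' m' = F (i', j') -> l != l' ->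
      l \notin [:: m; m'] -> l' \notin [:: m; m'] ->
      pr P (F (i, j) `&` F (i', j')) <= g * q j.+1 * q j'.+1.
    by move=> <- <-; exact: (pr_same_cellI_le mU indU uniformU (ltW a0) a1).
  (* With a common later vertex [j], the distinct vertices [i] and [i'] are the free ones and
     [z = z' = j]. *)
  move: le_j; rewrite leq_eqVlt => /predU1P[jj'|ltj].
    subst j'; move: ne; rewrite eqxx orbF => ne.
    apply: (key i j i' j) => //; rewrite !inE !negb_or !ltn_eqF//.
  (* [pr_same_cellI_le] wants in each pair a vertex outside the other one:
     [j'] in the later pair, and in the earlier pair [i] or [j], according to
     whether the shared vertex is [j]. *)
  have [ji'|ji'] := eqVneq j i'.
    apply: (key i j j' i'); rewrite ?inE ?negb_or //.
    - exact: same_cell_sym.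
    - by rewrite ltn_eqF// (ltn_trans ij).
    - by rewrite -ji' !ltn_eqF.
    - by rewrite -ji' !gtn_eqF.
  apply: (key j i j' i'); rewrite ?inE ?negb_or.
  - exact: same_cell_sym.
  - exact: same_cell_sym.
  - by rewrite ltn_eqF.
  - by rewrite gtn_eqF.
  - by rewrite !gtn_eqF// (ltn_trans ij).
have F1 p : p \in s -> pr P (F p) = g * q p.2.+1.
  move=> /sP[ij _]; apply: (pr_same_cell mU indU uniformU (ltW a0) a1) => //.
  by rewrite ltn_eqF.
have := pr_bigcup_second_moment (q := fun p => q p.2.+1) us mF
  (fun p => q0 _) mpos (ltW g0) F1 Fpair.
move=> /le_trans /(_ (le_pr P _ mEU FE)) h.
rewrite -lerBlDr; apply: le_trans (h _); last first.
  by apply: fin_bigcup_measurable => // p _; exact: mF.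
rewrite lerD2l lerN2 ler_pdivrMr// mulrC -ler_pdivrMr//.
by rewrite sumq ltW.
Qed.

(** Every tail union has probability 1, and the upper limit is their decreasing intersection. *)
Lemma lim_sup_edge_event1 : (0 < dim)%N ->
  (\sum_(0 <= n <oo) ((n%:R * y n ^+ dim)%:E))%E = +oo%E ->
  P (lim_sup_set E) = 1%E.
Proof.
move=> dim0 Soo.
have mE := measurable_edge_event.
have mU' N : measurable (\bigcup_(n in [set n | (N <= n)%N]) E n).
  by apply: bigcup_measurable => n _; exact: mE.
have P1 N : P (\bigcup_(n >= N) E n) = 1%E.
  rewrite prE//; congr EFin; apply/eqP; rewrite eq_le pr_le1//=.
  apply/ler_addgt0Pr => e e0.
  have d0 : 0 < dim%:R :> R by rewrite ltr0n.
  (* By Bernoulli, [(1 - a) ^+ dim >= 1 - dim * a >= 1 - e]; the [1 / 2] ensures [a < 1]. *)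
  pose a := Num.min (1 / 2) (e / dim%:R).
  have a0 : 0 < a by rewrite lt_min !divr_gt0.
  have a1 : a < 1 by rewrite gt_min; apply/orP; left; lra.
  have ae : dim%:R * a <= e by rewrite mulrC -ler_pdivlMr// ge_min lexx orbT.
  have := pr_bigcup_edge_event_ge N dim0 Soo a0 a1.
  have := ler_bernoulli dim (ltW a0) (ltW a1).
  by lra.
have h0 : (P (\bigcup_(n >= 0) E n) < +oo)%E by rewrite P1 ltry.
have /cvg_lim <- // := lim_sup_set_cvg P E mE h0.
rewrite (_ : (fun n => _) = fun=> 1%E) ?lim_cst//.
by apply/funext => n; exact: P1.
Qed.

End exponential_sample.

Theorem theorem3 (dP : measure_display) (T : measurableType dP) (R : realType)
  (P : probability T R) (dim : nat) (lambda : R)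
  (X : nat -> 'I_dim -> {RV P >-> R}) (y : nat -> R) :
  (1 <= dim)%N -> 0 < lambda ->
  mutually_independent P (fun p : nat * 'I_dim => (X p.1 p.2 : T -> R)) ->
  (forall (i : nat) (k : 'I_dim) (B : set R), measurable B ->
     P ((X i k : T -> R) @^-1` B) = exponential_prob lambda B) ->
  (forall n, 0 < y n) ->
  let E := lim_sup_set (fun n : nat =>
             [set w : T | (1 <= max_degree (fun i k => X i k w) n (y n))%N]) in
  ((\sum_(0 <= n <oo) ((n%:R * y n ^+ dim)%:E) < +oo)%E ->
     (forall m n : nat, (m <= n)%N -> y n <= y m) -> P E = 0%E) /\
  ((\sum_(0 <= n <oo) ((n%:R * y n ^+ dim)%:E))%E = +oo%E -> P E = 1%E).
Proof.
move=> dim0 lambda0 indX lawX y0 E; split=> [Sfin ymono|Soo].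
  exact: (lim_sup_edge_event0 lambda0 indX lawX).
exact: (lim_sup_edge_event1 lambda0 indX lawX).
Qed.
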